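(* For each of the two triples $S\in\{(P_1,P_3,P_4),\,(P_1,P_3,P_5)\}$, as formal power series in $x$, $$\sum_{n\ge 0}|\mathcal{M}_n(S)|\,x^n=\frac{1-5x+10x^2-9x^3+3x^4-x^5}{(1-x)^4(1-2x)}.$$
   Context: A matching with $n$ arcs is a partition of $\{1,2,\ldots,2n\}$ into blocks of size 2, called arcs; an arc is written $[a,b]$ with $a<b$, where $a$ is its opener and $b$ its closer. For $n=0$ there is exactly one (empty) matching. A matching is Stoimenow if it contains no pair of arcs $[i,\ell],[i+1,k]$ with $i+1<k<\ell$ (Type 1) and no pair of arcs $[k,j+1],[\ell,j]$ with $k<\ell<j$ (Type 2). A matching $M$ contains a pattern (a matching) $P$ with $m$ arcs if some $m$ arcs of $M$ become $P$ after their $2m$ endpoints are relabelled $1,\ldots,2m$ in the order-preserving way; otherwise $M$ avoids $P$. $\mathcal{M}_n(S)$ denotes the set of Stoimenow matchings with $n$ arcs avoiding every pattern in $S$. The patterns are $P_1=\{[1,3],[2,7],[4,5],[6,8]\}$, $P_3=\{[1,2],[3,5],[4,6],[7,8]\}$, $P_4=\{[1,2],[3,5],[4,7],[6,8]\}$, $P_5=\{[1,3],[2,5],[4,6],[7,8]\}$. *)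

(* Defs.v *)
From mathcomp Require Import all_boot all_order all_algebra.

Set Implicit Arguments.
Unset Strict Implicit.
Unset Printing Implicit Defensive.

Import GRing.Theory.

(* The paper's point a in {1, ..., 2n} is the element of 'I_(n.*2) of value
   a - 1.  The arc [a, b] is the block {a, b}: its opener is its smaller
   element and its closer the larger one. *)

Definition is_matching (n : nat) (M : {set {set 'I_(n.*2)}}) : bool :=
  partition M [set: 'I_(n.*2)] && [forall B in M, #|B| == 2].

(* The pair of arcs [i, l], [i+1, k] with i + 1 < k < l. *)
Definition has_type1 (n : nat) (M : {set {set 'I_(n.*2)}}) : bool :=
  [exists i : 'I_(n.*2), exists i' : 'I_(n.*2),
   exists k : 'I_(n.*2), exists l : 'I_(n.*2),
     [&& i' == i.+1 :> nat, i' < k, k < l,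
         [set i; l] \in M & [set i'; k] \in M]].

(* The pair of arcs [k, j+1], [l, j] with k < l < j. *)
Definition has_type2 (n : nat) (M : {set {set 'I_(n.*2)}}) : bool :=
  [exists j : 'I_(n.*2), exists j' : 'I_(n.*2),
   exists k : 'I_(n.*2), exists l : 'I_(n.*2),
     [&& j' == j.+1 :> nat, k < l, l < j,
         [set k; j'] \in M & [set l; j] \in M]].

Definition stoimenow (n : nat) (M : {set {set 'I_(n.*2)}}) : bool :=
  ~~ has_type1 M && ~~ has_type2 M.

(* f is the inverse of the order-preserving relabelling of the endpoints of
   the arcs of A by 1, ..., 2m. *)
Definition relabels_to (m n : nat) (A : {set {set 'I_(n.*2)}})
    (P : {set {set 'I_(m.*2)}}) : bool :=
  [exists f : {ffun 'I_(m.*2) -> 'I_(n.*2)},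
     [forall x : 'I_(m.*2), forall y : 'I_(m.*2), (x < y) ==> (f x < f y)] &&
     (A == [set f @: (B : {set 'I_(m.*2)}) | B in P])].

Definition contains (m n : nat) (M : {set {set 'I_(n.*2)}})
    (P : {set {set 'I_(m.*2)}}) : bool :=
  [exists A : {set {set 'I_(n.*2)}},
     [&& A \subset M, #|A| == m & relabels_to A P]].

Definition stoimenow_avoiding (m n : nat) (S : seq {set {set 'I_(m.*2)}}) :
    {set {set {set 'I_(n.*2)}}} :=
  [set M | [&& is_matching M, stoimenow M & all (fun P => ~~ contains M P) S]].

(* arc m a b is the block {a, b} in the 1-based numbering of the points. *)
Definition arc (m a b : nat) : {set 'I_(m.*2)} :=
  [set x : 'I_(m.*2) | x.+1 \in [:: a; b]].

Definition P1 : {set {set 'I_(4.*2)}} :=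
  [set arc 4 1 3; arc 4 2 7; arc 4 4 5; arc 4 6 8].
Definition P3 : {set {set 'I_(4.*2)}} :=
  [set arc 4 1 2; arc 4 3 5; arc 4 4 6; arc 4 7 8].
Definition P4 : {set {set 'I_(4.*2)}} :=
  [set arc 4 1 2; arc 4 3 5; arc 4 4 7; arc 4 6 8].
Definition P5 : {set {set 'I_(4.*2)}} :=
  [set arc 4 1 3; arc 4 2 5; arc 4 4 6; arc 4 7 8].

Local Open Scope ring_scope.

(* A formal power series is given by its sequence of coefficients. *)
Definition fps (R : Type) : Type := nat -> R.

Definition fps_of_poly (R : comUnitRingType) (p : {poly R}) : fps R :=
  fun n => p`_n.

Definition fps_mul (R : comUnitRingType) (f g : fps R) : fps R :=
  fun n => \sum_(i < n.+1) f i * g (n - i)%N.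

(* The first n + 1 coefficients of 1 / f, from the recurrence
   f_0 g_n = - \sum_(i < n) f_(n-i) g_i, for f_0 a unit. *)
Fixpoint fps_inv_coefs (R : comUnitRingType) (f : fps R) (n : nat) : seq R :=
  if n is k.+1 then
    let s := fps_inv_coefs f k in
    rcons s (- ((f 0%N)^-1 * \sum_(i < n) f (n - i)%N * s`_i))
  else [:: (f 0%N)^-1].

Definition fps_inv (R : comUnitRingType) (f : fps R) : fps R :=
  fun n => (fps_inv_coefs f n)`_n.

Definition fps_div (R : comUnitRingType) (f g : fps R) : fps R :=
  fps_mul f (fps_inv g).

Lemma size_fps_inv_coefs (R : comUnitRingType) (f : fps R) n :
  size (fps_inv_coefs f n) = n.+1.
Proof. by elim: n => //= n IHn; rewrite size_rcons IHn. Qed.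

Lemma nth_fps_inv_coefs (R : comUnitRingType) (f : fps R) n i :
  (i <= n)%N -> (fps_inv_coefs f n)`_i = fps_inv f i.
Proof.
elim: n => [|n IHn]; first by rewrite leqn0 => /eqP->.
rewrite leq_eqVlt => /predU1P[->//|lt_in].
by rewrite /= nth_rcons size_fps_inv_coefs lt_in IHn.
Qed.

Lemma fps_invS (R : comUnitRingType) (f : fps R) n :
  fps_inv f n.+1 =
  - ((f 0%N)^-1 * \sum_(i < n.+1) f (n.+1 - i)%N * fps_inv f i).
Proof.
rewrite {1}/fps_inv /= nth_rcons size_fps_inv_coefs ltnn eqxx.
congr (- (_ * _)); apply: eq_bigr => i _.
by rewrite nth_fps_inv_coefs // -ltnS.
Qed.

Lemma fps_divv (R : comUnitRingType) (f : fps R) :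
  f 0%N \is a GRing.unit -> fps_div f f =1 fps_of_poly 1.
Proof.
move=> Uf n; rewrite /fps_div /fps_mul /fps_of_poly coef1.
case: n => [|n]; first by rewrite big_ord1 /fps_inv /= divrr.
rewrite big_ord_recl subn0 fps_invS mulrN mulVKr //.
rewrite (reindex_inj rev_ord_inj) /=; apply/eqP.
rewrite addrC subr_eq0; apply/eqP; apply: eq_bigr => i _.
have le_in : (i <= n)%N by rewrite -ltnS.
rewrite /bump /= add1n !subSS.
by congr (f _ * fps_inv f _); rewrite subSn ?leq_subr // subKn.
Qed.

Definition avoid_gf (m : nat) (S : seq {set {set 'I_(m.*2)}}) : fps int :=
  fun n => #|stoimenow_avoiding n S|%:Z.

(* Main.v *)
Require Import Defs.
From mathcomp Require Import all_boot all_order all_algebra zify ring.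
(* From here on, arc is a block of a pattern and not an interval of a cycle. *)
Import Defs.
Import GRing.Theory.

Set Implicit Arguments.
Unset Strict Implicit.
Unset Printing Implicit Defensive.

(** Why the theorem holds.

    A nesting in a Stoimenow matching forces an occurrence of P1: if [i', k] is
    nested in [i, l], the leftmost closer after i comes before i' and its arc
    opens before i (otherwise consecutive openers, starting with i, would have a
    decreasing pair of closers, which Type 1 excludes), and symmetrically the
    rightmost opener before l comes after k and its arc closes after l.  Since
    Types 1 and 2 and P1 all contain a nesting, the Stoimenow matchings that
    avoid P1 are exactly the nonnesting matchings (nonnestingE).

    A nonnesting matching is determined by its set of openers.  Numbering the
    arcs from left to right, let h i be the number of arcs that lie wholly before
    arc i.  This gives a bijection onto the nondecreasing functions h with
    h i <= i, called profiles (matching_of_profileK, matching_of_profile_inj), in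
    which arc j lies wholly before arc i exactly when j < h i.  Patterns become
    inequalities: occurrences of P3 and P4 differ only in the relative position
    of the last two arcs, so avoiding both is a single condition on h, and the
    same happens for P3 and P5 (contains_P3_or_P4, contains_P3_or_P5).

    For n = N + 1 let m = h N be the largest value of h.  If h vanishes below m,
    equivalently if no three arcs lie one after the other, then h satisfies both
    conditions.  Sorting these profiles by the last zero q of h, what remains is a
    weakly increasing sequence of N - q values among q + 1, so there are
    'C(N, q) of them, and 2 ^ N in all (card_shallow).  Otherwise each condition
    forces h i = i from just after the last zero up to about m, and leaves three
    free parameters x < y < z <= N; this gives 'C(N + 1, 3) profiles in
    both cases (card_deep34, card_deep35).  Hence both triples have
    2 ^ (n - 1) + 'C(n, 3) avoiders for n > 0, whose generating function is the
    stated fraction: multiplied by the denominator it gives the numerator, and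
    this characterizes the quotient (fps_div_unique). *)

(** * Matchings as fixed-point-free involutions, and nestings *)

Lemma pair_set_inj (T : finType) (x y z : T) :
  [set x; y] = [set x; z] -> x != y -> y = z.
Proof.
move=> /setP/(_ y); rewrite !inE eqxx orbT eq_sym => /esym/orP[|/eqP//].
by move=> ->.
Qed.

(** The default x is never returned on a matching. *)
Definition partner n (M : {set {set 'I_(n.*2)}}) (x : 'I_(n.*2)) :=
  odflt x [pick y | (y != x) && ([set x; y] \in M)].

Lemma matching_card2 n (M : {set {set 'I_(n.*2)}}) B :
  is_matching M -> B \in M -> #|B| == 2.
Proof. by case/andP=> _ /forall_inP cM BM; apply: cM. Qed.

Lemma matching_neq n (M : {set {set 'I_(n.*2)}}) x y :
  is_matching M -> [set x; y] \in M -> x != y.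
Proof.
move=> MM /(matching_card2 MM); rewrite cards2.
by case: (x == y).
Qed.

Lemma matching_uniq n (M : {set {set 'I_(n.*2)}}) x y z :
  is_matching M -> [set x; y] \in M -> [set x; z] \in M -> y = z.
Proof.
move=> MM xyM xzM; apply: (pair_set_inj (x := x)); last exact: matching_neq xyM.
case/andP: MM => /and3P[_ /trivIsetP tM _] _.
apply/eqP/negPn/negP => /(tM _ _ xyM xzM) /pred0P/(_ x).
by rewrite /= !inE eqxx.
Qed.

Lemma partnerP n (M : {set {set 'I_(n.*2)}}) x :
  is_matching M -> (partner M x != x) && ([set x; partner M x] \in M).
Proof.
move=> MM; rewrite /partner; case: pickP => [y yP|none] /=; first exact: yP.
have /andP[/and3P[/eqP cM _ _] _] := MM.
have: x \in cover M by rewrite cM inE.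
rewrite /cover => /bigcupP[B BM xB].
have /cards2P[a [b [ab eB]]] := matching_card2 MM BM.
rewrite eB in xB BM; case/set2P: xB => ex; subst x.
  by have := none b; rewrite BM andbT eq_sym ab.
by have := none a; rewrite setUC BM andbT ab.
Qed.

Lemma mem_matching n (M : {set {set 'I_(n.*2)}}) x y :
  is_matching M -> ([set x; y] \in M) = (y == partner M x).
Proof.
move=> MM; have /andP[_ xpM] := partnerP x MM.
apply/idP/eqP => [xyM|->//]; exact: matching_uniq xyM xpM.
Qed.

Lemma partner_neq n (M : {set {set 'I_(n.*2)}}) x :
  is_matching M -> partner M x != x :> nat.
Proof. by move=> MM; case/andP: (partnerP x MM). Qed.

Lemma partnerK n (M : {set {set 'I_(n.*2)}}) :
  is_matching M -> involutive (partner M).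
Proof.
by move=> MM x; apply/esym/eqP; rewrite -mem_matching // setUC mem_matching.
Qed.

Lemma partner_inj n (M : {set {set 'I_(n.*2)}}) :
  is_matching M -> injective (partner M).
Proof. by move=> MM; apply: inv_inj (partnerK MM). Qed.

Lemma matching_partner_inj n (M M' : {set {set 'I_(n.*2)}}) :
  is_matching M -> is_matching M' -> partner M =1 partner M' -> M = M'.
Proof.
move=> MM MM' eqp; apply/setP => B; apply/idP/idP => BM.
  have /cards2P[a [b [_ eB]]] := matching_card2 MM BM.
  by move: BM; rewrite eB !mem_matching // eqp.
have /cards2P[a [b [_ eB]]] := matching_card2 MM' BM.
by move: BM; rewrite eB !mem_matching // eqp.
Qed.

Definition openers n (M : {set {set 'I_(n.*2)}}) : {set 'I_(n.*2)} :=
  [set x : 'I_(n.*2) | x < partner M x].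

Lemma partner_openers n (M : {set {set 'I_(n.*2)}}) x :
  is_matching M -> (partner M x \in openers M) = (x \notin openers M).
Proof.
move=> MM; rewrite !inE (partnerK MM) -leqNgt ltn_neqAle.
by rewrite partner_neq.
Qed.

Definition nonnesting n (M : {set {set 'I_(n.*2)}}) : bool :=
  [forall x in openers M, forall y in openers M,
     (x < y) ==> (partner M x < partner M y)].

Lemma nonnestingP n (M : {set {set 'I_(n.*2)}}) :
  reflect {in openers M &, forall x y : 'I_(n.*2),
             x < y -> partner M x < partner M y}
          (nonnesting M).
Proof.
apply: (iffP forall_inP) => [H x y Ox Oy|H x Ox].
  by move/forall_inP: (H x Ox) => /(_ y Oy)/implyP.
by apply/forall_inP => y Oy; apply/implyP/H.
Qed.

(** In a run of consecutive openers the closers increase; the run may start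
    with a point i that is not itself known to be an opener. *)
Lemma opener_run_increasing N (p : 'I_N -> 'I_N) :
  (forall i i' : 'I_N, i' = i.+1 :> nat -> i' < p i' -> p i <= p i') ->
  forall i i' : 'I_N, i <= i' ->
    (forall x : 'I_N, i < x <= i' -> x < p x) -> p i <= p i'.
Proof.
move=> no1 i i'; move: i' {-2}(val i') (erefl (val i')) => /= i' k.
elim: k i' => [|k IH] i' ei'.
  move=> le_ii' _; suff -> : i = i' by [].
  by apply: val_inj => /=; lia.
rewrite leq_eqVlt => /orP[/eqP e _|lt_ii' opn].
  by rewrite (val_inj e).
have ltk : k < N by have := ltn_ord i'; lia.
have le_pk : p i <= p (Ordinal ltk).
  apply: IH => //=; first by lia.
  by move=> x /andP[lt_ix le_xk]; apply: opn; lia.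
apply: leq_trans le_pk _; apply: no1 => /=; first by [].
by apply: opn; lia.
Qed.

(** The left half of the occurrence of P1 around a nesting: c is the leftmost
    closer after i.  Its arc cannot start after i, as the points from i to p c
    would then be a run of openers in which p i exceeds the closer c. *)
Lemma arc_over_left_end N (p : 'I_N -> 'I_N) :
  involutive p -> (forall x, p x != x :> nat) ->
  (forall i i' : 'I_N, i' = i.+1 :> nat -> i' < p i' -> p i <= p i') ->
  forall i i' : 'I_N, i < i' -> i' < p i' -> p i' < p i ->
  exists c : 'I_N, [/\ p c < i, i < c & c < i'].
Proof.
move=> pK pN no1 i i' lt_ii' op_i' nest.
pose cl (c : 'I_N) := (i < c < i') && (p c < c).
have [c0 Pc0|none] := pickP cl; last first.
  suff: p i <= p i' by lia.
  apply: opener_run_increasing => // [|x /andP[lt_ix le_xi']]; first exact: ltnW.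
  have := none x; rewrite /cl lt_ix /=; have := pN x.
  move: le_xi'; rewrite leq_eqVlt => /orP[/eqP e|->] /=; last by lia.
  by rewrite (val_inj e).
case: (arg_minnP (P := cl) (fun c : 'I_N => c : nat) Pc0) => c.
move=> /andP[/andP[lt_ic lt_ci'] cl_c] min_c.
exists c; split=> //; rewrite ltnNge leq_eqVlt; apply/negP=> /orP[/eqP e|lt_ipc].
  by have := congr1 p (val_inj e); rewrite pK => epi; move: nest; rewrite epi; lia.
have: p i <= p (p c).
  apply: opener_run_increasing => // [|x /andP[lt_ix le_xpc]]; first exact: ltnW.
  rewrite ltnNge leq_eqVlt negb_or pN /=; apply/negP => cl_x.
  have := min_c x; rewrite /cl lt_ix cl_x /=; lia.
by rewrite pK; lia.
Qed.

(** The mirror image of the previous lemma: reversing the order of the points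
    turns Type 2 pairs into Type 1 pairs. *)
Lemma arc_over_right_end N (p : 'I_N -> 'I_N) :
  involutive p -> (forall x, p x != x :> nat) ->
  (forall j j' : 'I_N, j' = j.+1 :> nat -> p j < j -> p j <= p j') ->
  forall i i' : 'I_N, i < i' -> i' < p i' -> p i' < p i ->
  exists o : 'I_N, [/\ p i' < o, o < p i & p i < p o].
Proof.
move=> pK pN no2 i i' lt_ii' op_i' nest.
pose q x := rev_ord (p (rev_ord x)).
have [||||||c] := @arc_over_left_end N q _ _ _ (rev_ord (p i)) (rev_ord (p i')).
- by move=> x; rewrite /q rev_ordK pK rev_ordK.
- move=> x; rewrite /q /=; have := pN (rev_ord x); have := ltn_ord x.
  by have := ltn_ord (p (rev_ord x)); rewrite /=; lia.
- move=> a b e; rewrite /q => lt_b.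
  have := no2 (rev_ord b) (rev_ord a) _ _; rewrite /=.
  move: lt_b; rewrite /=; have := ltn_ord a; have := ltn_ord b.
  have := ltn_ord (p (rev_ord a)); have := ltn_ord (p (rev_ord b)).
  lia.
- by rewrite /=; have := ltn_ord (p i); have := ltn_ord (p i'); lia.
- by rewrite /q rev_ordK pK /=; have := ltn_ord i'; have := ltn_ord (p i'); lia.
- by rewrite /q !rev_ordK !pK /=; have := ltn_ord i; have := ltn_ord i'; lia.
case; rewrite /q /= => h1 h2 h3; exists (rev_ord c); split=> /=.
all: have := ltn_ord (p (rev_ord c)); have := ltn_ord c; have := ltn_ord (p i);
  have := ltn_ord (p i'); lia.
Qed.

(** * Patterns, and nonnesting matchings *)

Definition proper_arc (m : nat) (ab : nat * nat) : bool :=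
  [&& 0 < ab.1, ab.1 < ab.2 & ab.2 <= m.*2].

(** These conditions make the blocks of the pattern distinct, so that the
    cardinality condition in an occurrence is automatic. *)
Definition arc_list (m : nat) (ps : seq (nat * nat)) : bool :=
  [&& size ps == m, uniq ps & all (proper_arc m) ps].

Definition pattern (m : nat) (ps : seq (nat * nat)) : {set {set 'I_(m.*2)}} :=
  [set:: [seq arc m ab.1 ab.2 | ab <- ps]].

Lemma mem_arc m a b (x : 'I_(m.*2)) : (x \in arc m a b) = (x.+1 == a) || (x.+1 == b).
Proof. by rewrite inE !inE. Qed.

Lemma arc_inj m : {in proper_arc m &, injective (fun ab => arc m ab.1 ab.2)}.
Proof.
move=> [a b] [c d] /and3P[/= a0 ab bm] /and3P[/= c0 cd dm] /setP e.
have mem k : 0 < k <= m.*2 -> (k == a) || (k == b) = ((k == c) || (k == d)).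
  move=> km; have lt_k : k.-1 < m.*2 by lia.
  have := e (Ordinal lt_k); rewrite !mem_arc /= prednK //; lia.
have := mem a; have := mem b; have := mem c; have := mem d.
by move=> *; congr pair; lia.
Qed.

Lemma card_pattern m ps : arc_list m ps -> #|pattern m ps| = m.
Proof.
case/and3P=> /eqP sz un /allP bd; rewrite /pattern cardsE.
have /card_uniqP -> : uniq [seq arc m ab.1 ab.2 | ab <- ps].
  rewrite map_inj_in_uniq // => ab cd /bd abm /bd cdm; exact: arc_inj.
by rewrite size_map.
Qed.

Lemma imset_arc m n ab (s : nat -> 'I_(n.*2)) (f : 'I_(m.*2) -> 'I_(n.*2)) :
  proper_arc m ab -> (forall x, f x = s x.+1) ->
  f @: arc m ab.1 ab.2 = [set s ab.1; s ab.2].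
Proof.
case: ab => a b /and3P[/= a0 lt_ab bm] fs; apply/setP => y; apply/imsetP/set2P.
  by case=> x; rewrite mem_arc fs => /orP[]/eqP-> ->; [left|right].
have lt_a : a.-1 < m.*2 by lia.
have lt_b : b.-1 < m.*2 by lia.
case=> ->; [exists (Ordinal lt_a)|exists (Ordinal lt_b)].
all: rewrite ?mem_arc ?fs /= ?prednK ?eqxx ?orbT //; lia.
Qed.

(** An occurrence is given by the images s 1 < ... < s m.*2 of the points of the
    pattern; s 0 is a dummy, so that s follows the 1-based numbering. *)
Lemma containsP m n (M : {set {set 'I_(n.*2)}}) ps : 0 < m -> arc_list m ps ->
  reflect (exists2 s : nat -> 'I_(n.*2),
             forall i j, 0 < i -> i < j -> j <= m.*2 -> s i < s j &
             {in ps, forall ab, [set s ab.1; s ab.2] \in M})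
          (contains M (pattern m ps)).
Proof.
move=> m_gt0 psP; have cP := card_pattern psP; case/and3P: psP => sz _ /allP bd.
apply: (iffP existsP) => [[A /and3P[sAM _ /existsP[f /andP[mf /eqP eA]]]]|[s ms sM]].
  (* Points are numbered from 1 by s and from 0 by f, hence the predecessor; the
     default x0 is only returned off the range 1, ..., m.*2. *)
  have x0P : 0 < m.*2 by lia.
  pose x0 := Ordinal x0P; exists (fun k => f (insubd x0 k.-1)) => [i j i0 lt_ij jm|].
    move/forallP/(_ (insubd x0 i.-1))/forallP/(_ (insubd x0 j.-1))/implyP: mf; apply.
    by rewrite !val_insubd !ifT; lia.
  move=> ab abps; apply: (subsetP sAM); rewrite eA.
  rewrite -(imset_arc (f := f) (s := fun k => f (insubd x0 k.-1)) (bd _ abps)).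
    by apply: imset_f; rewrite inE; apply/mapP; exists ab.
  by move=> x /=; rewrite valKd.
pose f := [ffun x : 'I_(m.*2) => s x.+1].
have mf (x y : 'I_(m.*2)) : x < y -> f x < f y.
  by move=> lt_xy; rewrite !ffunE; apply: ms => //; apply: ltn_ord.
have f_inj : injective f.
  by move=> x y e; have [/mf|/mf|/val_inj//] := ltngtP x y; rewrite e ltnn.
exists [set f @: (B : {set 'I_(m.*2)}) | B in pattern m ps]; apply/and3P; split.
- apply/subsetP=> _ /imsetP[_ /[!inE] /mapP[ab abps ->] ->].
  rewrite (imset_arc (s := s)) ?sM ?bd // => x; by rewrite ffunE.
- by rewrite card_imset ?cP //; apply: imset_inj.
apply/existsP; exists f; rewrite eqxx andbT.
by apply/forallP => x; apply/forallP => y; apply/implyP/mf.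
Qed.

(** Builds the map required by containsP from an explicit list; the extra head
    fills the dummy index 0. *)
Lemma nth_increasing N (x : 'I_N) (l : seq 'I_N) : sorted ltn (map val l) ->
  forall i j, 0 < i -> i < j -> j <= size l -> nth x (x :: l) i < nth x (x :: l) j.
Proof.
move=> sl [//|i] [//|j] _ lt_ij le_j /=.
rewrite -!(nth_map x (val x) val) ?(leq_trans lt_ij) //; try lia.
apply: (sorted_ltn_nth ltn_trans (val x) sl); rewrite ?inE ?size_map //.
exact: ltnW (leq_trans lt_ij le_j).
Qed.

Definition arcs1 := [:: (1, 3); (2, 7); (4, 5); (6, 8)].
Definition arcs3 := [:: (1, 2); (3, 5); (4, 6); (7, 8)].
Definition arcs4 := [:: (1, 2); (3, 5); (4, 7); (6, 8)].
Definition arcs5 := [:: (1, 3); (2, 5); (4, 6); (7, 8)].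

Lemma P1E : P1 = pattern 4 arcs1.
Proof. by apply/setP => B; rewrite !inE -!orbA. Qed.
Lemma P3E : P3 = pattern 4 arcs3.
Proof. by apply/setP => B; rewrite !inE -!orbA. Qed.
Lemma P4E : P4 = pattern 4 arcs4.
Proof. by apply/setP => B; rewrite !inE -!orbA. Qed.
Lemma P5E : P5 = pattern 4 arcs5.
Proof. by apply/setP => B; rewrite !inE -!orbA. Qed.

Lemma type1P n (M : {set {set 'I_(n.*2)}}) : is_matching M ->
  reflect (forall i i' : 'I_(n.*2), i' = i.+1 :> nat -> i' < partner M i' ->
             partner M i <= partner M i')
          (~~ has_type1 M).
Proof.
move=> MM; apply: (iffP idP) => [no1 i i' ei lt_i'|no1].
  rewrite leqNgt; apply: contra no1 => lt_pp.
  apply/existsP; exists i; apply/existsP; exists i'.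
  apply/existsP; exists (partner M i'); apply/existsP; exists (partner M i).
  by rewrite !mem_matching // !eqxx ei lt_pp -ei lt_i' eqxx.
apply/negP => /existsP[i /existsP[i' /existsP[k /existsP[l]]]].
rewrite !mem_matching // => /and5P[/eqP ei lt_i'k lt_kl /eqP el /eqP ek].
by have := no1 i i' ei; rewrite -el -ek; lia.
Qed.

Lemma type2P n (M : {set {set 'I_(n.*2)}}) : is_matching M ->
  reflect (forall j j' : 'I_(n.*2), j' = j.+1 :> nat -> partner M j < j ->
             partner M j <= partner M j')
          (~~ has_type2 M).
Proof.
move=> MM; apply: (iffP idP) => [no2 j j' ej lt_j|no2].
  rewrite leqNgt; apply: contra no2 => lt_pp.
  apply/existsP; exists j; apply/existsP; exists j'.
  apply/existsP; exists (partner M j'); apply/existsP; exists (partner M j).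
  rewrite ![[set partner M _; _]]setUC !mem_matching // !eqxx ej lt_pp lt_j.
  by rewrite -ej eqxx.
apply/negP => /existsP[j /existsP[j' /existsP[k /existsP[l]]]].
rewrite ![[set _; j]]setUC ![[set _; j']]setUC !mem_matching //.
move=> /and5P[/eqP ej lt_kl lt_lj /eqP ek /eqP el].
by have := no2 j j' ej; rewrite -el -ek; lia.
Qed.

(** Types 1 and 2 and P1 all contain a nesting.  Conversely, the arcs over the two
    ends of a nesting complete it to an occurrence of P1. *)
Lemma nonnestingE n (M : {set {set 'I_(n.*2)}}) : is_matching M ->
  nonnesting M = stoimenow M && ~~ contains M P1.
Proof.
move=> MM; rewrite P1E; apply/idP/idP => [/nonnestingP nn|].
  have pn := partner_neq _ MM; have pK := partnerK MM.
  apply/andP; split.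
    apply/andP; split.
      apply/type1P => // i i' ei lt_i'; have [lt_i|] := ltnP i (partner M i); last by lia.
      by apply/ltnW/nn; rewrite ?inE // ei.
    apply/type2P => // j j' ej lt_j.
    have [lt_j'|] := ltnP (partner M j') j'; last by lia.
    rewrite leqNgt; apply/negP => /nn; rewrite !inE !pK; lia.
  apply/negP => /containsP[]// s ms sM.
  have := sM (2, 7) isT; have := sM (4, 5) isT; rewrite !mem_matching //=.
  move=> /eqP e5 /eqP e7.
  have := nn (s 2) (s 4); rewrite !inE -e5 -e7.
  move=> /(_ (ms 2 7 isT isT isT) (ms 4 5 isT isT isT) (ms 2 4 isT isT isT)).
  by have := ms 5 7 isT isT isT; lia.
case/andP=> /andP[/(type1P MM) no1 /(type2P MM) no2].
have pN x := partner_neq x MM; have pK := partnerK MM.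
apply: contraR; rewrite negb_forall_in => /exists_inP[x Ox].
rewrite negb_forall_in => /exists_inP[y Oy]; rewrite negb_imply -leqNgt.
case/andP=> lt_xy; rewrite leq_eqVlt => /orP[/eqP/val_inj/(partner_inj MM) e|nest].
  by rewrite e ltnn in lt_xy.
move: Ox Oy; rewrite !inE => Ox Oy.
have [c [lt_pcx lt_xc lt_cy]] := arc_over_left_end pK pN no1 lt_xy Oy nest.
have [o [lt_yo lt_ox lt_xpo]] := arc_over_right_end pK pN no2 lt_xy Oy nest.
apply/containsP => //.
pose pts := [:: x; partner M c; x; c; y; partner M y; o; partner M x; partner M o].
exists (nth x pts) => [|ab].
  apply: (@nth_increasing _ x (behead pts)).
  by rewrite /= lt_pcx lt_xc lt_cy Oy lt_yo lt_ox lt_xpo.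
rewrite !inE => /or4P[] /eqP-> /=; by rewrite ?[[set partner M _; _]]setUC mem_matching.
Qed.

(** * The matching of a profile *)

(** h i stands for the number of arcs that end before arc i begins, when the arcs
    of a nonnesting matching are numbered from left to right. *)
Definition profiles n : {set {ffun 'I_n -> 'I_n}} :=
  [set h : {ffun 'I_n -> 'I_n} | [forall i, h i <= i] &&
    [forall i : 'I_n, forall j : 'I_n, (i <= j) ==> (h i <= h j)]].

Lemma profilesP n (h : {ffun 'I_n -> 'I_n}) :
  reflect ((forall i, h i <= i) /\ (forall i j : 'I_n, i <= j -> h i <= h j))
          (h \in profiles n).
Proof.
rewrite inE; apply: (iffP andP) => -[/forallP le_h mono_h]; split=> //.
  by move=> i j le_ij; move/forallP/(_ i)/forallP/(_ j)/implyP: mono_h; apply.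
by apply/forallP=> i; apply/forallP=> j; apply/implyP/mono_h.
Qed.

(** The number of openers that precede the closer of arc k: arc j opens before
    that closer unless arc k is among the h j arcs that end before arc j. *)
Definition reach n (h : {ffun 'I_n -> 'I_n}) (k : nat) : nat := #|[set j | h j <= k]|.

Lemma opener_subproof n (h : {ffun 'I_n -> 'I_n}) (i : 'I_n) : i + h i < n.*2.
Proof. by have := ltn_ord i; have := ltn_ord (h i); lia. Qed.

Lemma closer_subproof n (h : {ffun 'I_n -> 'I_n}) (i : 'I_n) :
  i + reach h i < n.*2.
Proof.
have : reach h i <= n by rewrite -[leqRHS]card_ord max_card.
by have := ltn_ord i; lia.
Qed.

(** The points before the opener of arc i are the i earlier openers and h i
    closers; those before its closer are the i earlier closers and reach h i
    openers. *)
Definition opener n h i : 'I_(n.*2) := Ordinal (@opener_subproof n h i).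
Definition closer n h i : 'I_(n.*2) := Ordinal (@closer_subproof n h i).

Definition matching_of_profile n (h : {ffun 'I_n -> 'I_n}) :
    {set {set 'I_(n.*2)}} :=
  [set [set opener h i; closer h i] | i : 'I_n].

Lemma card_ord_lt n k : #|[set j : 'I_n | j < k]| = minn n k.
Proof.
rewrite cardsE -sum1_card; have [le_kn|/ltnW le_nk] := leqP k n.
  by rewrite -[RHS](card_ord k) -sum1_card (big_ord_widen n (fun=> 1)).
rewrite -[RHS](card_ord n) -sum1_card; apply: eq_bigl => i.
by apply: leq_trans (ltn_ord i) le_nk.
Qed.

Section MatchingOfProfile.
Variables (n : nat) (h : {ffun 'I_n -> 'I_n}).
Hypothesis hP : h \in profiles n.

Lemma opener_increasing (i j : 'I_n) : (opener h i < opener h j) = (i < j).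
Proof.
have [_ mono_h] := profilesP _ hP; rewrite /=.
have [lt|lt|/val_inj->] := ltngtP i j; last by rewrite ltnn.
  by have := mono_h _ _ (ltnW lt); lia.
by have := mono_h _ _ (ltnW lt); lia.
Qed.

Lemma closer_increasing (i j : 'I_n) : (closer h i < closer h j) = (i < j).
Proof.
have mono a b : a <= b -> reach h a <= reach h b.
  move=> le_ab; apply: subset_leq_card; apply/subsetP => k.
  rewrite !inE; lia.
rewrite /=; have [lt|lt|/val_inj->] := ltngtP i j; last by rewrite ltnn.
  by have := mono _ _ (ltnW lt); lia.
by have := mono _ _ (ltnW lt); lia.
Qed.

(** As h is nondecreasing, reach h j counts an initial segment, which contains i
    unless j < h i.  The order of the endpoints of all arcs follows from this. *)
Lemma profile_galois (i j : 'I_n) : (reach h j <= i) = (j < h i).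
Proof.
have [_ mono_h] := profilesP _ hP; have lt_i := ltn_ord i.
have [lt_j|le_h] := ltnP j (h i).
  rewrite -[leqRHS](minn_idPr (ltnW lt_i)) -card_ord_lt; apply: subset_leq_card.
  apply/subsetP => k; rewrite !inE => le_j; rewrite ltnNge; apply/negP => /mono_h.
  by lia.
apply/negbTE; rewrite -ltnNge.
rewrite -[i.+1](minn_idPr lt_i) -card_ord_lt; apply: subset_leq_card.
by apply/subsetP => k; rewrite !inE => le_k; have := mono_h k i le_k; lia.
Qed.

Lemma closer_lt_opener (i j : 'I_n) : (closer h j < opener h i) = (j < h i).
Proof. by have := profile_galois i j; rewrite /=; lia. Qed.

Lemma opener_lt_closer (i j : 'I_n) : (opener h i < closer h j) = (h i <= j).
Proof. by have := profile_galois i j; rewrite /=; lia. Qed.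

Lemma opener_inj : injective (opener h).
Proof.
move=> i j e; have := opener_increasing i j; have := opener_increasing j i.
by rewrite e ltnn; have [//|//|/val_inj] := ltngtP i j.
Qed.

Lemma closer_inj : injective (closer h).
Proof.
move=> i j e; have := closer_increasing i j; have := closer_increasing j i.
by rewrite e ltnn; have [//|//|/val_inj] := ltngtP i j.
Qed.

Lemma opener_neq_closer i j : (opener h i == closer h j) = false.
Proof.
apply/negbTE/eqP => /(congr1 val) /= e.
have := closer_lt_opener i j; have := opener_lt_closer i j.
by rewrite /= -e ltnn; lia.
Qed.

(** The n.*2 openers and closers are distinct, hence they exhaust the points. *)
Lemma opener_or_closer x : exists i, x = opener h i \/ x = closer h i.
Proof.
pose u (s : 'I_n + 'I_n) := match s with inl i => opener h i | inr i => closer h i end.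
have u_inj : injective u.
  move=> [i|i] [j|j] /= e; first by rewrite (opener_inj e).
  - by have := opener_neq_closer i j; rewrite e eqxx.
  - by have := opener_neq_closer j i; rewrite e eqxx.
  - by rewrite (closer_inj e).
have card_u : #|'I_(n.*2)| <= #|{: 'I_n + 'I_n}| by rewrite card_sum !card_ord addnn.
have /codomP[[i|i] ->] := inj_card_onto u_inj card_u x.
  by exists i; left.
by exists i; right.
Qed.

Lemma matching_of_profile_is_matching : is_matching (matching_of_profile h).
Proof.
have eq_arc i j x : x \in [set opener h i; closer h i] ->
    x \in [set opener h j; closer h j] -> i = j.
  move=> /set2P[]-> /set2P[] => [/opener_inj|/eqP|/esym/eqP|/closer_inj] //.
    by rewrite opener_neq_closer.
  by rewrite opener_neq_closer.
apply/andP; split; last first.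
  by apply/forall_inP=> _ /imsetP[i _ ->]; rewrite cards2 opener_neq_closer.
apply/and3P; split.
- apply/eqP/setP => x; rewrite inE; apply/bigcupP.
  have [i xi] := opener_or_closer x.
  exists [set opener h i; closer h i]; first exact: imset_f.
  by apply/set2P.
- apply/trivIsetP=> _ _ /imsetP[i _ ->] /imsetP[j _ ->]; apply: contraR.
  by case/pred0Pn=> x /andP[xi xj]; rewrite (eq_arc i j x).
apply/imsetP => -[i _ /setP/(_ (opener h i))].
by rewrite !inE eqxx.
Qed.

Lemma partner_opener i : partner (matching_of_profile h) (opener h i) = closer h i.
Proof.
apply/esym/eqP; rewrite -mem_matching ?matching_of_profile_is_matching //.
exact: imset_f.
Qed.

Lemma mem_openers x : (x \in openers (matching_of_profile h)) = (x \in codom (opener h)).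
Proof.
have MM := matching_of_profile_is_matching.
have [le_h _] := profilesP _ hP.
have op i : opener h i \in openers (matching_of_profile h).
  by rewrite inE partner_opener opener_lt_closer le_h.
have [i [->|->]] := opener_or_closer x; first by rewrite op codom_f.
rewrite -partner_opener partner_openers // op partner_opener.
by apply/esym/codomP => -[j /esym/eqP]; rewrite opener_neq_closer.
Qed.

Lemma nonnesting_matching_of_profile : nonnesting (matching_of_profile h).
Proof.
apply/nonnestingP => x y; rewrite !mem_openers => /codomP[i ->] /codomP[j ->].
by rewrite !partner_opener opener_increasing closer_increasing.
Qed.

Lemma arc_of_profile (x y : 'I_(n.*2)) : x < y ->
  [set x; y] \in matching_of_profile h -> exists i, x = opener h i /\ y = closer h i.
Proof.
have MM := matching_of_profile_is_matching.
rewrite mem_matching // => lt_xy /eqP ey.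
have: x \in openers (matching_of_profile h) by rewrite inE -ey.
rewrite mem_openers => /codomP[i ex]; exists i; split=> //.
by rewrite ey ex partner_opener.
Qed.
End MatchingOfProfile.

(** * The profile of a nonnesting matching *)

Definition rank N (A : {set 'I_N}) (x : nat) : nat := #|[set y in A | y < x]|.

Lemma leq_rank N (A : {set 'I_N}) x y : x <= y -> rank A x <= rank A y.
Proof.
move=> le_xy; apply: subset_leq_card; apply/subsetP => z; rewrite !inE.
by case/andP=> -> /= lt_zx; apply: leq_trans lt_zx le_xy.
Qed.

Lemma ltn_rank N (A : {set 'I_N}) (x : 'I_N) y : x \in A -> x < y -> rank A x < rank A y.
Proof.
move=> Ax lt_xy; apply: proper_card; apply/properP; split.
  apply/subsetP => z; rewrite !inE => /andP[-> /= lt_zx]; exact: ltn_trans lt_zx lt_xy.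
by exists x; rewrite !inE Ax ?lt_xy ?ltnn.
Qed.

Lemma rank_inj N (A : {set 'I_N}) : {in A &, injective (fun x : 'I_N => rank A x)}.
Proof.
move=> x y Ax Ay /= e.
by have [/(ltn_rank Ax)|/(ltn_rank Ay)|/val_inj//] := ltngtP x y; rewrite e ltnn.
Qed.

(** The points before x are counted by A and its complement; for A the set of
    openers this reads off a profile from the position of x. *)
Lemma rank_setC N (A : {set 'I_N}) (x : 'I_N) : rank A x + rank (~: A) x = x.
Proof.
have := cardsID A [set y : 'I_N | y < x].
rewrite card_ord_lt (minn_idPr (ltnW (ltn_ord x))) => e; rewrite -[RHS]e.
by congr (_ + _); apply: eq_card => y; rewrite !inE andbC.
Qed.

(** The rank is injective on A, so at most k elements have rank below k; the
    largest of them bounds all the others. *)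
Lemma card_rank_lt N (A : {set 'I_N}) k : #|[set x in A | rank A x < k]| <= k.
Proof.
have [->|[x0 x0P]] := set_0Vmem [set x in A | rank A x < k]; first by rewrite cards0.
case: (arg_maxnP (P := [in [set x in A | rank A x < k]]) val x0P) => x.
rewrite !inE => /andP[Ax lt_xk] max_x; apply: leq_trans lt_xk.
have -> : (rank A x).+1 = #|x |: [set y in A | y < x]|.
  by rewrite cardsU1 !inE ltnn andbF.
apply: subset_leq_card; apply/subsetP => y yP; have := max_x _ yP.
move: yP; rewrite !inE => /andP[-> _] /= le_yx.
by rewrite -val_eqE /= -leq_eqVlt.
Qed.

Section NonnestingMatching.
Variables (n : nat) (M : {set {set 'I_(n.*2)}}).
Hypothesis MM : is_matching M.
Local Notation O := (openers M).

Lemma imset_partner_openers : partner M @: O = ~: O.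
Proof.
apply/setP => y; rewrite -{1}[y](partnerK MM) mem_imset; last exact: partner_inj.
by rewrite partner_openers // in_setC.
Qed.

Lemma card_openers : #|O| = n.
Proof.
have := cardsC O; rewrite -imset_partner_openers card_imset; last exact: partner_inj.
by rewrite card_ord addnn => /double_inj.
Qed.

Lemma rank_openers_lt x : x \in O -> rank O x < n.
Proof.
move=> Ox; rewrite -[ltnRHS]card_openers; apply: proper_card; apply/properP; split.
  by apply/subsetP => z; rewrite inE => /andP[].
by exists x => //; rewrite !inE ltnn andbF.
Qed.

(** Without nestings the i-th opener is matched with the i-th closer. *)
Lemma rank_partner x : nonnesting M -> x \in O ->
  rank (~: O) (partner M x) = rank O x.
Proof.
move=> /nonnestingP nn Ox; rewrite /rank -[RHS](card_imset _ (partner_inj MM)).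
apply: eq_card => y.
rewrite -[y](partnerK MM) mem_imset; last exact: partner_inj.
move: (partner M y) => z; rewrite in_set in_setC partner_openers // negbK.
rewrite [in RHS]in_set.
apply: andb_id2l => Oz; have [lt|lt|/val_inj->] := ltngtP z x; last by rewrite ltnn.
  exact: nn.
by apply/negbTE; rewrite -leqNgt ltnW // nn.
Qed.

(** A closer precedes the opener of arc i exactly when at most i openers precede
    that closer; counting by rank avoids an enumeration of the arcs. *)
Definition profile_of : {ffun 'I_n -> 'I_n} :=
  [ffun i : 'I_n => insubd i #|[set y in ~: O | rank O y <= i]|].

(** The partner of a closer preceded by at most i openers is one of the first i
    openers. *)
Lemma card_closers_le (i : 'I_n) : #|[set y in ~: O | rank O y <= i]| <= i.
Proof.
apply: leq_trans (card_rank_lt O i).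
rewrite -(card_imset _ (partner_inj MM)); apply: subset_leq_card.
apply/subsetP => _ /imsetP[y yP ->]; move: yP.
rewrite inE in_setC -partner_openers // => /andP[Opy le_y].
rewrite inE Opy /=; apply: leq_trans le_y; apply: (ltn_rank (Opy)).
by move: Opy; rewrite inE partnerK.
Qed.

Lemma profile_ofE (i : 'I_n) : profile_of i = #|[set y in ~: O | rank O y <= i]| :> nat.
Proof.
by rewrite ffunE val_insubd ifT // (leq_ltn_trans (card_closers_le i)).
Qed.

Lemma profile_of_profiles : profile_of \in profiles n.
Proof.
apply/profilesP; split=> [i|i j le_ij]; rewrite !profile_ofE.
  exact: card_closers_le.
apply: subset_leq_card; apply/subsetP => y; rewrite !inE => /andP[-> /= le_y].
exact: leq_trans le_y le_ij.
Qed.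

Lemma profile_of_rank x (i : 'I_n) : x \in O -> i = rank O x :> nat ->
  profile_of i = rank (~: O) x :> nat.
Proof.
move=> Ox ei; rewrite profile_ofE ei; apply: eq_card => y.
rewrite in_set [in RHS]in_set; apply: andb_id2l; rewrite in_setC => cl_y.
have [le_xy|lt_yx] := leqP x y; last by rewrite leq_rank // ltnW.
apply/negbTE; rewrite -ltnNge ltn_rank // ltn_neqAle le_xy andbT.
by apply: contraNneq cl_y => /val_inj <-.
Qed.

Lemma profile_of_rank_opener x (i : 'I_n) : x \in O -> i = rank O x :> nat ->
  opener profile_of i = x.
Proof.
by move=> Ox ei; apply: val_inj; rewrite /= (profile_of_rank Ox ei) ei rank_setC.
Qed.
End NonnestingMatching.

(** By rank_partner the openers and their complement determine the arcs. *)
Lemma nonnesting_openers_inj n (M M' : {set {set 'I_(n.*2)}}) :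
  is_matching M -> nonnesting M -> is_matching M' -> nonnesting M' ->
  openers M = openers M' -> M = M'.
Proof.
move=> MM nM MM' nM' eO; apply: matching_partner_inj => //.
have eq_op x : x \in openers M -> partner M x = partner M' x.
  move=> Ox; have Ox' : x \in openers M' by rewrite -eO.
  apply: (rank_inj (A := ~: openers M)) => /=.
  - by rewrite in_setC partner_openers // negbK.
  - by rewrite in_setC eO partner_openers // negbK.
  by rewrite rank_partner // [in RHS]eO rank_partner // eO.
move=> x; have [/eq_op//|cl_x] := boolP (x \in openers M).
have Opx : partner M x \in openers M by rewrite partner_openers.
apply: (partner_inj MM'); rewrite partnerK //.
by rewrite -(eq_op _ Opx) partnerK.
Qed.

Lemma matching_of_profileK n (M : {set {set 'I_(n.*2)}}) :
  is_matching M -> nonnesting M -> matching_of_profile (profile_of M) = M.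
Proof.
move=> MM nM; have hP := profile_of_profiles MM.
have MM' := matching_of_profile_is_matching hP.
apply: nonnesting_openers_inj => //; first exact: nonnesting_matching_of_profile.
apply/esym/eqP; rewrite eqEcard !card_openers // leqnn andbT.
apply/subsetP => x Ox; rewrite mem_openers //.
apply/codomP; exists (Ordinal (rank_openers_lt MM Ox)).
exact/esym/profile_of_rank_opener.
Qed.

Lemma rank_opener n h (i : 'I_n) : h \in profiles n ->
  rank (openers (matching_of_profile h)) (opener h i) = i.
Proof.
move=> hP; rewrite -[RHS](minn_idPr (ltnW (ltn_ord i))) -card_ord_lt.
rewrite -(card_imset _ (opener_inj hP)); apply: eq_card => x.
rewrite inE mem_openers //; apply/andP/imsetP => [[/codomP[j ->]]|[j]].
  by rewrite opener_increasing // => lt_j; exists j; rewrite ?inE.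
by rewrite inE => lt_j ->; rewrite codom_f opener_increasing.
Qed.

Lemma matching_of_profile_inj n :
  {in profiles n &, injective (@matching_of_profile n)}.
Proof.
move=> h h' hP hP' e; apply/ffunP => i; apply: val_inj.
have /(congr1 val)/= : opener h i = opener h' i.
  apply: (rank_inj (A := openers (matching_of_profile h))) => /=.
  - by rewrite mem_openers ?codom_f.
  - by rewrite e mem_openers ?codom_f.
  by rewrite rank_opener // e rank_opener.
by move/addnI.
Qed.

(** As profiles parametrize the nonnesting matchings, only the remaining patterns
    have to be translated. *)
Lemma card_stoimenow_avoiding_P1 n S :
  #|stoimenow_avoiding n (P1 :: S)| =
  #|[set h in profiles n | all (fun P => ~~ contains (matching_of_profile h) P) S]|.
Proof.
rewrite -(card_in_imset (f := @matching_of_profile n)); last first.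
  by move=> h h' /setIdP[hP _] /setIdP[hP' _]; apply: matching_of_profile_inj.
apply: eq_card => M; rewrite inE /=; apply/idP/imsetP => [|[h]].
  case/and4P=> MM sM aM1 aM.
  have nM : nonnesting M by rewrite nonnestingE // sM.
  have eM := matching_of_profileK MM nM.
  by exists (profile_of M) => //; apply/setIdP; rewrite profile_of_profiles // eM.
case/setIdP=> hP ah ->.
have MM := matching_of_profile_is_matching hP.
have := nonnesting_matching_of_profile hP; rewrite nonnestingE // MM ah andbT.
by case/andP=> -> ->.
Qed.

(** * Patterns in terms of profiles *)

Section ProfilePatterns.
Variables (n : nat) (h : {ffun 'I_n -> 'I_n}).
Hypothesis hP : h \in profiles n.

Lemma contains_of_list ps (x : 'I_(n.*2)) (l : seq 'I_(n.*2)) :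
  arc_list 4 ps -> size l = 8 -> sorted ltn (map val l) ->
  all (fun ab => [set nth x (x :: l) ab.1; nth x (x :: l) ab.2]
                   \in matching_of_profile h) ps ->
  contains (matching_of_profile h) (pattern 4 ps).
Proof.
move=> psP sz_l sl /allP lM; apply/(containsP _ _ psP) => //.
by exists (nth x (x :: l)) => // i j i0 lt_ij le_j; apply: nth_increasing; rewrite ?sz_l.
Qed.

Lemma arc_of_profile_mem i : [set opener h i; closer h i] \in matching_of_profile h.
Proof. exact: imset_f. Qed.

(** In P3, P4 and P5 the position of each endpoint relative to its neighbours
    translates to an inequality by closer_lt_opener (arc j ends before arc i
    begins iff j < h i) and its negation opener_lt_closer; a, b, c, d are the
    arcs in increasing order of their openers. *)
Lemma contains_P3 :
  reflect (exists a b c d : 'I_n, [/\ a < h b, b < c, h c <= b & c < h d])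
          (contains (matching_of_profile h) P3).
Proof.
have [le_h _] := profilesP _ hP; have oc i : opener h i < closer h i.
  by rewrite opener_lt_closer // le_h.
rewrite P3E; apply: (iffP idP) => [|].
  case/(containsP _ (isT : 0 < 4) (isT : arc_list 4 arcs3)) => s ms sM.
  have [a [_ ea']] := arc_of_profile hP (ms 1 2 isT isT isT) (sM (1, 2) isT).
  have [b [eb eb']] := arc_of_profile hP (ms 3 5 isT isT isT) (sM (3, 5) isT).
  have [c [ec ec']] := arc_of_profile hP (ms 4 6 isT isT isT) (sM (4, 6) isT).
  have [d [ed _]] := arc_of_profile hP (ms 7 8 isT isT isT) (sM (7, 8) isT).
  exists a, b, c, d; rewrite -!closer_lt_opener // -opener_lt_closer //.
  by rewrite -(opener_increasing hP b) -ea' -eb -eb' -ec -ec' -ed !ms.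
case=> a [b [c [d []]]]; rewrite -!closer_lt_opener // -opener_lt_closer //.
move=> ab bc cb cd.
pose l := [:: opener h a; closer h a; opener h b; opener h c; closer h b; closer h c;
              opener h d; closer h d].
apply: (@contains_of_list _ (opener h a) l) => //=; last by rewrite !arc_of_profile_mem.
by rewrite !oc ab cd cb opener_increasing // bc closer_increasing // bc.
Qed.

Lemma contains_P4 :
  reflect (exists a b c d : 'I_n,
             [/\ a < h b, b < c, h c <= b & [/\ b < h d, h d <= c & c < d]])
          (contains (matching_of_profile h) P4).
Proof.
have [le_h _] := profilesP _ hP; have oc i : opener h i < closer h i.
  by rewrite opener_lt_closer // le_h.
rewrite P4E; apply: (iffP idP) => [|].
  case/(containsP _ (isT : 0 < 4) (isT : arc_list 4 arcs4)) => s ms sM.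
  have [a [_ ea']] := arc_of_profile hP (ms 1 2 isT isT isT) (sM (1, 2) isT).
  have [b [eb eb']] := arc_of_profile hP (ms 3 5 isT isT isT) (sM (3, 5) isT).
  have [c [ec ec']] := arc_of_profile hP (ms 4 7 isT isT isT) (sM (4, 7) isT).
  have [d [ed ed']] := arc_of_profile hP (ms 6 8 isT isT isT) (sM (6, 8) isT).
  exists a, b, c, d; rewrite -!closer_lt_opener // -!opener_lt_closer //.
  rewrite -(opener_increasing hP b) -(closer_increasing hP c).
  by rewrite -ea' -eb -eb' -ec -ec' -ed -ed' !ms.
case=> a [b [c [d []]]]; rewrite -!closer_lt_opener // -!opener_lt_closer //.
move=> ab bc cb [bd dc cd].
pose l := [:: opener h a; closer h a; opener h b; opener h c; closer h b; opener h d;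
              closer h c; closer h d].
apply: (@contains_of_list _ (opener h a) l) => //=; last by rewrite !arc_of_profile_mem.
by rewrite oc ab bd dc cb opener_increasing // bc closer_increasing // cd.
Qed.

Lemma contains_P5 :
  reflect (exists a b c d : 'I_n,
             [/\ a < b, h b <= a, a < h c & [/\ h c <= b, b < c & c < h d]])
          (contains (matching_of_profile h) P5).
Proof.
have [le_h _] := profilesP _ hP; have oc i : opener h i < closer h i.
  by rewrite opener_lt_closer // le_h.
rewrite P5E; apply: (iffP idP) => [|].
  case/(containsP _ (isT : 0 < 4) (isT : arc_list 4 arcs5)) => s ms sM.
  have [a [ea ea']] := arc_of_profile hP (ms 1 3 isT isT isT) (sM (1, 3) isT).
  have [b [eb eb']] := arc_of_profile hP (ms 2 5 isT isT isT) (sM (2, 5) isT).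
  have [c [ec ec']] := arc_of_profile hP (ms 4 6 isT isT isT) (sM (4, 6) isT).
  have [d [ed _]] := arc_of_profile hP (ms 7 8 isT isT isT) (sM (7, 8) isT).
  exists a, b, c, d; rewrite -!closer_lt_opener // -!opener_lt_closer //.
  rewrite -(opener_increasing hP a) -(closer_increasing hP b).
  by rewrite -ea -ea' -eb -eb' -ec -ec' -ed !ms.
case=> a [b [c [d []]]]; rewrite -!closer_lt_opener // -!opener_lt_closer //.
move=> ab ba ac [cb bc cd].
pose l := [:: opener h a; opener h b; closer h a; opener h c; closer h b; closer h c;
              opener h d; closer h d].
apply: (@contains_of_list _ (opener h a) l) => //=; last by rewrite !arc_of_profile_mem.
by rewrite oc ba ac cb cd opener_increasing // ab closer_increasing // bc.
Qed.

(** P3 and P4 agree except that the last arc begins after or before the third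
    one ends, so their union leaves that relation open; the first arc may be
    taken to be arc 0, whence the condition 0 < h b. *)
Lemma contains_P3_or_P4 :
  reflect (exists b c d : 'I_n, [/\ 0 < h b, b < c, h c <= b & (b < h d) && (c < d)])
    (contains (matching_of_profile h) P3 || contains (matching_of_profile h) P4).
Proof.
have [le_h _] := profilesP _ hP.
apply: (iffP orP) => [[/contains_P3|/contains_P4]|].
- move=> [a [b [c [d [ab bc cb cd]]]]]; exists b, c, d; split=> //; first lia.
  by have := le_h d; lia.
- by move=> [a [b [c [d [ab bc cb [bd dc cd]]]]]]; exists b, c, d; split=> //; lia.
move=> [b [c [d [b0 bc cb /andP[bd cd]]]]].
have n0 : 0 < n := leq_ltn_trans (leq0n _) (ltn_ord b).
have [lt_ch|le_hc] := ltnP c (h d).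
  by left; apply/contains_P3; exists (Ordinal n0), b, c, d.
by right; apply/contains_P4; exists (Ordinal n0), b, c, d.
Qed.

(** P3 and P5 agree except that the first arc ends before or after the second
    one begins, so their union leaves that relation open. *)
Lemma contains_P3_or_P5 :
  reflect (exists b c d : 'I_n, [/\ 0 < h c, b < c, h c <= b & c < h d])
    (contains (matching_of_profile h) P3 || contains (matching_of_profile h) P5).
Proof.
have [le_h _] := profilesP _ hP.
apply: (iffP orP) => [[/contains_P3|/contains_P5]|].
- move=> [a [b [c [d [ab bc cb cd]]]]]; exists b, c, d; split=> //.
  have [_ mono_h] := profilesP _ hP; have := mono_h _ _ (ltnW bc); lia.
- by move=> [a [b [c [d [ab ba ac [cb bc cd]]]]]]; exists b, c, d; split=> //; lia.
move=> [b [c [d [c0 bc cb cd]]]].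
have n0 : 0 < n := leq_ltn_trans (leq0n _) (ltn_ord b).
have [hb0|b0] := posnP (h b).
  right; apply/contains_P5; exists (Ordinal n0), b, c, d; rewrite hb0; split=> //=.
  exact: leq_trans c0 cb.
by left; apply/contains_P3; exists (Ordinal n0), b, c, d.
Qed.
End ProfilePatterns.

(** * Profiles without three arcs in a row *)

(** An arc i with 0 < h i comes after arc 0, and i < h ord_max means that it comes
    before the last arc: a profile is shallow when no three arcs lie one after
    the other. *)
Definition shallow N (h : {ffun 'I_N.+1 -> 'I_N.+1}) : bool :=
  [forall i, (0 < h i) ==> (h ord_max <= i)].

Lemma leq_ord_max N (i : 'I_N.+1) : i <= N.
Proof. by rewrite -ltnS. Qed.

Definition profile_of_fun N (f : nat -> nat) : {ffun 'I_N.+1 -> 'I_N.+1} :=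
  [ffun i : 'I_N.+1 => inord (f i)].

Lemma profile_of_funE N (f : nat -> nat) (i : 'I_N.+1) :
  f i <= i -> profile_of_fun N f i = f i :> nat.
Proof. by move=> le_f; rewrite ffunE inordK // (leq_ltn_trans le_f). Qed.

Lemma profile_of_fun_profiles N (f : nat -> nat) :
  (forall i, i <= N -> f i <= i) ->
  (forall i j, i <= j -> j <= N -> f i <= f j) ->
  profile_of_fun N f \in profiles N.+1.
Proof.
move=> le_f mono_f; have le_ord (i : 'I_N.+1) : f i <= i := le_f i (leq_ord_max i).
apply/profilesP; split=> [i|i j le_ij]; rewrite !profile_of_funE //.
exact: mono_f (leq_ord_max j).
Qed.

Definition last_zero N (h : {ffun 'I_N.+1 -> 'I_N.+1}) : 'I_N.+1 :=
  [arg max_(i > ord0 | h i == 0 :> nat) i]%N.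

Lemma last_zeroP N (h : {ffun 'I_N.+1 -> 'I_N.+1}) (i : 'I_N.+1) :
  h \in profiles N.+1 -> (h i == 0 :> nat) = (i <= last_zero h).
Proof.
move=> /profilesP[le_h mono_h]; pose z (i : 'I_N.+1) := h i == 0 :> nat.
have z0 : z ord0 by rewrite /z -leqn0; apply: (le_h ord0).
rewrite /last_zero; case: (arg_maxnP (P := z) val z0) => q /eqP hq max_q.
apply/idP/idP => [/max_q//|/mono_h]; by rewrite hq leqn0.
Qed.

(** The profile whose last zero is q and whose later values, diminished by 1, are
    listed in s. *)
Definition staircase q (s : seq nat) (i : nat) : nat :=
  if i <= q then 0 else (nth 0 s (i - q.+1)).+1.

(** A shallow profile with last zero q has values in [1, q + 1] after q, and any
    weakly increasing choice of these N - q values is a profile: the bound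
    h i <= i then holds since q < i. *)
Lemma card_shallow_fibre N (q : 'I_N.+1) :
  #|[set h in profiles N.+1 | shallow h & last_zero h == q]| = 'C(N, q).
Proof.
have le_qN : q <= N := leq_ord_max q.
have <- : 'C((N - q) + q, N - q) = 'C(N, q) by rewrite subnK // bin_sub.
rewrite -card_sorted_tuples.
pose H (t : (N - q).-tuple 'I_q.+1) := profile_of_fun N (staircase q (map val t)).
have bound (t : (N - q).-tuple 'I_q.+1) k : nth 0 (map val t) k <= q.
  have [lt_k|le_k] := ltnP k (size t); last by rewrite nth_default // size_map.
  by rewrite (nth_map ord0) //; apply: (ltn_ord (nth ord0 t k)).
have le_H (t : (N - q).-tuple 'I_q.+1) i : staircase q (map val t) i <= i.
  rewrite /staircase; case: (leqP i q) => // lt_qi.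
  by apply: leq_trans lt_qi; rewrite ltnS bound.
rewrite -(card_in_imset (f := H)); last first.
  move=> t u _ _ /ffunP e; apply/val_inj/(inj_map val_inj)/(eq_from_nth (x0 := 0)).
    by rewrite !size_map !size_tuple.
  move=> k; rewrite size_map size_tuple => lt_k.
  have lt_i : q.+1 + k < N.+1 by lia.
  have := congr1 val (e (Ordinal lt_i)); rewrite /H /= !profile_of_funE //=.
  by rewrite /staircase [_ <= q]leqNgt leq_addr /= addKn => -[].
apply: eq_card => h; apply/setIdP/imsetP => [[hP]|[t]].
  case/andP=> /forallP sh /eqP eq_q.
  have [le_h mono_h] := profilesP _ hP.
  have zero i : (h i == 0 :> nat) = (i <= q) by rewrite last_zeroP // eq_q.
  have le_hS i : h i <= q.+1.
    apply: leq_trans (mono_h i ord_max (leq_ord_max i)) _.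
    have [eqN|lt_qN] := eqVneq (val q) N; first by rewrite eqN leqW // -ltnS.
    have lt_q1 : q.+1 < N.+1 by rewrite ltnS ltn_neqAle lt_qN.
    apply: (implyP (sh (Ordinal lt_q1))).
    by rewrite lt0n zero /= ltnn.
  pose v (j : nat) := (h (inord (q.+1 + j))).-1.
  pose t := [tuple (inord (v j) : 'I_q.+1) | j < N - q].
  have nth_t j : j < N - q -> nth 0 (map val t) j = v j.
    move=> lt_j; rewrite (nth_map ord0) ?size_tuple //.
    rewrite -[j]/(val (Ordinal lt_j)) -tnth_nth tnth_mktuple /= inordK //.
    by have := le_hS (inord (q.+1 + j)); rewrite /v; lia.
  exists t; last first.
    apply/ffunP=> i; apply: val_inj; rewrite /= profile_of_funE // /staircase.
    have [le_iq|lt_qi] := leqP i q; first by apply/eqP; rewrite zero.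
    have lt_i := ltn_ord i; rewrite nth_t; last by lia.
    by rewrite /v subnKC // inord_val prednK // lt0n zero -ltnNge.
  rewrite inE; apply/(sortedP 0) => j; rewrite size_map size_tuple => lt_j.
  rewrite !nth_t ?(ltnW lt_j) // /v.
  have : h (inord (q.+1 + j)) <= h (inord (q.+1 + j.+1)).
    by apply: mono_h; rewrite !inordK; lia.
  by lia.
rewrite inE => st ->.
have mono_t i j : i <= j -> j <= N ->
    staircase q (map val t) i <= staircase q (map val t) j.
  rewrite /staircase => le_ij le_jN; case: (leqP i q) => // lt_qi; rewrite [j <= q]leqNgt.
  rewrite (leq_trans lt_qi le_ij) /= ltnS.
  apply: (sorted_leq_nth leq_trans leqnn 0 st); rewrite ?inE ?size_map ?size_tuple; lia.
have HP : H t \in profiles N.+1 by apply: profile_of_fun_profiles.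
have zero i : (H t i == 0 :> nat) = (i <= q).
  by rewrite profile_of_funE // /staircase; case: leqP.
split=> //; apply/andP; split.
  apply/forallP => i; apply/implyP; rewrite lt0n zero -ltnNge => lt_qi.
  rewrite profile_of_funE // /staircase; case: ifP => // _.
  by apply: leq_trans lt_qi; rewrite ltnS bound.
have := last_zeroP q HP; rewrite zero leqnn => le_q.
have := last_zeroP (last_zero (H t)) HP; rewrite zero leqnn => ge_q.
by apply/eqP/val_inj/eqP; rewrite eqn_leq ge_q -le_q.
Qed.

(** The fibres of last_zero have binomial sizes, and these sum to 2 ^ N. *)
Lemma card_shallow N : #|[set h in profiles N.+1 | shallow h]| = 2 ^ N.
Proof.
rewrite -sum1_card (partition_big (@last_zero N) xpredT) //=.
under eq_bigr => q _.
  rewrite sum1dep_card.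
  have -> : #|[set h | (h \in [set h in profiles N.+1 | shallow h])
                       && (last_zero h == q)]| = 'C(N, q).
    by rewrite -card_shallow_fibre; apply: eq_card => h; rewrite !in_set andbA.
  over.
rewrite -[2]/(1 + 1) expnDn; apply: eq_bigr => q _.
by rewrite !exp1n !muln1.
Qed.

(** * Profiles with three arcs in a row *)

Definition increasing_triples n : {set 'I_n * 'I_n * 'I_n} :=
  [set u : 'I_n * 'I_n * 'I_n | u.1.1 < u.1.2 < u.2].

Lemma card_increasing_triples n : #|increasing_triples n| = 'C(n, 3).
Proof.
rewrite -card_ltn_sorted_tuples.
pose f (u : 'I_n * 'I_n * 'I_n) : 3.-tuple 'I_n := [tuple u.1.1; u.1.2; u.2].
rewrite -(card_in_imset (f := f)); last first.
  by move=> [[x y] z] [[x' y'] z'] _ _ /(congr1 val)[-> -> ->].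
apply: eq_card => t; apply/imsetP/idP => [[[[x y] z]]|].
  by rewrite !inE /= => /andP[xy yz] ->; rewrite /= xy yz.
case/tupleP: t => x t; case/tupleP: t => y t; case/tupleP: t => z t.
rewrite (tuple0 t) inE /= andbT => xyz; exists (x, y, z); first by rewrite inE.
exact: val_inj.
Qed.

Ltac split_ifs_lia := repeat (case: ifP => ?); lia.

(** Here y is the first arc with a predecessor, x.+1 is its number of
    predecessors, and z is the largest value. *)
Definition deep_profile34 (x y z i : nat) : nat :=
  if i < y then 0 else if i == y then x.+1 else minn i z.

(** Here x is the last zero, y.+1 is the largest value, and z is the first place
    where that value is attained. *)
Definition deep_profile35 (x y z i : nat) : nat :=
  if i <= x then 0 else if i <= y then i else if i < z then y else y.+1.

(** For i past the first positive place p and up to the maximum f N, the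
    condition at b = i - 1, c = i, d = N gives i - 1 < f i, so f i = i; past the
    maximum f is constant.  Given p and f N, only f p is free. *)
Lemma deep_profile34_shape N (f : nat -> nat) :
  (forall i, i <= N -> f i <= i) -> (forall i j, i <= j -> j <= N -> f i <= f j) ->
  (exists p, [/\ 0 < f p, p < f N & forall i, i < p -> f i = 0]) ->
  (forall b c d, 0 < f b -> b < c -> c < d -> d <= N -> b < f d -> b < f c) ->
  exists x y z, [/\ x < y, y < z, z <= N &
                    forall i, i <= N -> f i = deep_profile34 x y z i].
Proof.
move=> le_f mono_f [p [p0 lt_p fp]] ok.
have le_m := le_f N (leqnn N); have le_p : f p <= p by apply: le_f; lia.
have climb i : p < i -> i <= f N -> f i = i.
  move=> lt_pi le_im; have [lt_iN|eN] : i < N \/ i = N by lia.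
    have f0 : 0 < f i.-1 by apply: leq_trans p0 _; apply: mono_f; lia.
    have lt_fi : i.-1 < f i by apply: (ok _ _ N) => //; lia.
    by have := le_f i; lia.
  by rewrite eN in le_im *; lia.
exists (f p).-1, p, (f N); split; try lia.
move=> i le_iN; rewrite /deep_profile34.
have [/fp-> //|lt_pi|->] := ltngtP i p; last by rewrite prednK.
have [le_im|lt_mi] := leqP i (f N); first exact: climb.
have := climb (f N) lt_p (leqnn _); have := mono_f (f N) i (ltnW lt_mi) le_iN.
have := mono_f i N le_iN (leqnn N); lia.
Qed.

(** For i from the first positive place p and below the maximum f N, the
    condition at b = i - 1, c = i, d = N gives i - 1 < f i, so f i = i.  After
    that f is f N - 1 or f N, so that given p and f N only the place of this last
    step is free. *)
Lemma deep_profile35_shape N (f : nat -> nat) :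
  (forall i, i <= N -> f i <= i) -> (forall i j, i <= j -> j <= N -> f i <= f j) ->
  (exists p, [/\ 0 < f p, p < f N & forall i, i < p -> f i = 0]) ->
  (forall b c d, 0 < f c -> b < c -> c < d -> d <= N -> c < f d -> b < f c) ->
  exists x y z, [/\ x < y, y < z, z <= N &
                    forall i, i <= N -> f i = deep_profile35 x y z i].
Proof.
move=> le_f mono_f [p [p0 lt_p fp]] ok.
have le_m := le_f N (leqnn N); have le_p : f p <= p by apply: le_f; lia.
have diag i : p <= i -> i < f N -> f i = i.
  move=> le_pi lt_im; have f0 : 0 < f i by apply: leq_trans p0 _; apply: mono_f; lia.
  have lt_fi : i.-1 < f i by apply: (ok _ _ N) => //; lia.
  by have := le_f i; lia.
have exZ : exists i, f N <= f i by exists N.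
case: (ex_minnP exZ) => z le_fz min_z.
have le_zN : z <= N by apply: min_z.
have le_z := le_f z le_zN.
exists p.-1, (f N).-1, z; split; try lia.
move=> i le_iN; rewrite /deep_profile35.
case: ifP => [lt_ip|lt_pi]; first by apply: fp; lia.
case: ifP => [lt_im|le_mi]; first by apply: diag; lia.
have fy : f (f N).-1 = (f N).-1 by apply: diag; lia.
have le_fy : f (f N).-1 <= f i by apply: mono_f; lia.
have le_fi : f i <= f N by apply: mono_f.
case: ifP => [lt_iz|le_zi]; last by have := mono_f z i; lia.
by have := min_z i; lia.
Qed.

(** Every profile comes from a function on nat, which keeps the arithmetic of the
    shapes free of bounds in the indices. *)
Lemma profile_of_fun_inord N (h : {ffun 'I_N.+1 -> 'I_N.+1}) :
  h = profile_of_fun N (fun i => h (inord i)).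
Proof. by apply/ffunP => i; rewrite ffunE !inord_val. Qed.

Lemma profile_fun_bounds N (h : {ffun 'I_N.+1 -> 'I_N.+1}) :
  h \in profiles N.+1 -> let f i : nat := h (inord i) in
  (forall i, i <= N -> f i <= i) /\ (forall i j, i <= j -> j <= N -> f i <= f j).
Proof.
case/profilesP=> le_h mono_h; split=> [i le_i|i j le_ij le_j].
  by have := le_h (inord i); rewrite inordK.
by apply: mono_h; rewrite !inordK // (leq_ltn_trans le_ij).
Qed.

Section ProfileOfFun.
Variables (N : nat) (f : nat -> nat).
Hypothesis le_f : forall i, i <= N -> f i <= i.
Hypothesis mono_f : forall i j, i <= j -> j <= N -> f i <= f j.
Local Notation h := (profile_of_fun N f).

Let hE (i : 'I_N.+1) : h i = f i :> nat.
Proof. by apply: profile_of_funE; apply: le_f (leq_ord_max i). Qed.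

Lemma not_shallowP :
  reflect (exists p, [/\ 0 < f p, p < f N & forall i, i < p -> f i = 0]) (~~ shallow h).
Proof.
have le_N := le_f (leqnn N).
rewrite negb_forall; apply: (iffP existsP) => [[b]|[p [p0 lt_p _]]].
  rewrite negb_imply !hE -ltnNge => /andP[b0 lt_b].
  have exp : exists i, 0 < f i by exists b.
  case: (ex_minnP exp) => p p0 min_p; exists p; split=> // [|i lt_ip].
    exact: leq_ltn_trans (min_p b b0) lt_b.
  by apply/eqP; rewrite -leqn0 leqNgt; apply/negP => /min_p; rewrite leqNgt lt_ip.
have lt_pN : p < N.+1 by apply: ltn_trans lt_p _.
by exists (Ordinal lt_pN); rewrite negb_imply !hE /= p0 -ltnNge.
Qed.

Lemma avoids_P3_P4P :
  reflect (forall b c d, 0 < f b -> b < c -> c < d -> d <= N -> b < f d -> b < f c)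
    (~~ (contains (matching_of_profile h) P3 || contains (matching_of_profile h) P4)).
Proof.
have hP : h \in profiles N.+1 by apply: profile_of_fun_profiles.
apply: (iffP negP) => [no b c d b0 bc cd dN bd|ok /(contains_P3_or_P4 hP)]; last first.
  case=> b [c [d []]]; rewrite !hE => b0 bc cb /andP[bd cd].
  by have := ok b c d b0 bc cd (leq_ord_max d) bd; rewrite ltnNge cb.
have dn : d < N.+1 by []; have cn := ltn_trans cd dn; have bn := ltn_trans bc cn.
rewrite ltnNge; apply/negP => cb; apply/no/(contains_P3_or_P4 hP).
by exists (Ordinal bn), (Ordinal cn), (Ordinal dn); rewrite !hE /= bd cd.
Qed.

Lemma avoids_P3_P5P :
  reflect (forall b c d, 0 < f c -> b < c -> c < d -> d <= N -> c < f d -> b < f c)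
    (~~ (contains (matching_of_profile h) P3 || contains (matching_of_profile h) P5)).
Proof.
have hP : h \in profiles N.+1 by apply: profile_of_fun_profiles.
apply: (iffP negP) => [no b c d c0 bc cd dN cfd|ok /(contains_P3_or_P5 hP)]; last first.
  case=> b [c [d []]]; rewrite !hE => c0 bc cb cd.
  have lt_cd : c < d := leq_trans cd (le_f (leq_ord_max d)).
  by have := ok b c d c0 bc lt_cd (leq_ord_max d) cd; rewrite ltnNge cb.
have dn : d < N.+1 by []; have cn := ltn_trans cd dn; have bn := ltn_trans bc cn.
rewrite ltnNge; apply/negP => cb; apply/no/(contains_P3_or_P5 hP).
by exists (Ordinal bn), (Ordinal cn), (Ordinal dn); rewrite !hE.
Qed.
End ProfileOfFun.

Section Deep.
Variable N : nat.
Local Notation n := N.+1.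

Definition deep34 : {set {ffun 'I_n -> 'I_n}} :=
  [set h in profiles n | ~~ shallow h &
     ~~ (contains (matching_of_profile h) P3 || contains (matching_of_profile h) P4)].

Definition deep35 : {set {ffun 'I_n -> 'I_n}} :=
  [set h in profiles n | ~~ shallow h &
     ~~ (contains (matching_of_profile h) P3 || contains (matching_of_profile h) P5)].

Lemma deep34E : deep34 =
  [set profile_of_fun N (deep_profile34 u.1.1 u.1.2 u.2)
     | u : 'I_n * 'I_n * 'I_n in increasing_triples n].
Proof.
apply/setP => h; apply/setIdP/imsetP => [[hP]|[[[x y] z]]].
  have [le_f mono_f] := profile_fun_bounds hP; rewrite [h]profile_of_fun_inord.
  case/andP=> /(not_shallowP le_f) deep /(avoids_P3_P4P le_f mono_f) ok.
  have [x [y [z [xy yz zN fE]]]] := deep_profile34_shape le_f mono_f deep ok.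
  have lt_z : z < n by [].
  have lt_y := ltn_trans yz lt_z; have lt_x := ltn_trans xy lt_y.
  exists (Ordinal lt_x, Ordinal lt_y, Ordinal lt_z); first by rewrite inE /= xy.
  by apply/ffunP => i; rewrite !ffunE fE ?leq_ord_max.
rewrite inE /= => /andP[xy yz] ->; have zN := leq_ord_max z.
have le_f i : i <= N -> deep_profile34 x y z i <= i.
  by move=> _; rewrite /deep_profile34; split_ifs_lia.
have mono_f i j : i <= j -> j <= N -> deep_profile34 x y z i <= deep_profile34 x y z j.
  by move=> le_ij _; rewrite /deep_profile34; split_ifs_lia.
split; first exact: profile_of_fun_profiles.
apply/andP; split.
  apply/(not_shallowP le_f); exists y; rewrite /deep_profile34 ltnn eqxx; split=> //.
    by split_ifs_lia.
  by move=> i ->.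
apply/(avoids_P3_P4P le_f mono_f) => b c d.
by rewrite /deep_profile34; split_ifs_lia.
Qed.

(** The parameters are recovered from the profile: y is the first positive
    place, x + 1 the value there, and z the value at N. *)
Lemma card_deep34 : #|deep34| = 'C(n, 3).
Proof.
rewrite deep34E card_in_imset ?card_increasing_triples //.
move=> [[x y] z] [[x' y'] z']; rewrite !inE /= => /andP[xy yz] /andP[xy' yz'] /ffunP e.
have le_f a b c i : a < b -> b < c -> deep_profile34 a b c i <= i.
  by rewrite /deep_profile34; split_ifs_lia.
have ev i : i <= N -> deep_profile34 x y z i = deep_profile34 x' y' z' i.
  move=> le_i; have lt_i : i < n by [].
  by have := congr1 val (e (Ordinal lt_i)); rewrite /= !profile_of_funE ?le_f.
have zN := leq_ord_max z; have zN' := leq_ord_max z'.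
have ey := ev y (ltnW (leq_trans yz zN)); have ey' := ev y' (ltnW (leq_trans yz' zN')).
have eN := ev N (leqnn N); rewrite /deep_profile34 in ey ey' eN.
have eyy : y = y' by apply: val_inj; move: ey ey'; rewrite /=; split_ifs_lia.
subst y'; have exx : x = x'.
  by apply: val_inj; move: ey; rewrite ltnn eqxx => -[].
have ezz : z = z' by apply: val_inj; move: eN; rewrite /=; split_ifs_lia.
by rewrite exx ezz.
Qed.

Lemma deep35E : deep35 =
  [set profile_of_fun N (deep_profile35 u.1.1 u.1.2 u.2)
     | u : 'I_n * 'I_n * 'I_n in increasing_triples n].
Proof.
apply/setP => h; apply/setIdP/imsetP => [[hP]|[[[x y] z]]].
  have [le_f mono_f] := profile_fun_bounds hP; rewrite [h]profile_of_fun_inord.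
  case/andP=> /(not_shallowP le_f) deep /(avoids_P3_P5P le_f mono_f) ok.
  have [x [y [z [xy yz zN fE]]]] := deep_profile35_shape le_f mono_f deep ok.
  have lt_z : z < n by [].
  have lt_y := ltn_trans yz lt_z; have lt_x := ltn_trans xy lt_y.
  exists (Ordinal lt_x, Ordinal lt_y, Ordinal lt_z); first by rewrite inE /= xy.
  by apply/ffunP => i; rewrite !ffunE fE ?leq_ord_max.
rewrite inE /= => /andP[xy yz] ->; have zN := leq_ord_max z.
have le_f i : i <= N -> deep_profile35 x y z i <= i.
  by move=> _; rewrite /deep_profile35; split_ifs_lia.
have mono_f i j : i <= j -> j <= N -> deep_profile35 x y z i <= deep_profile35 x y z j.
  by move=> le_ij _; rewrite /deep_profile35; split_ifs_lia.
split; first exact: profile_of_fun_profiles.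
apply/andP; split.
  apply/(not_shallowP le_f); exists x.+1; rewrite /deep_profile35; split.
  - by split_ifs_lia.
  - by split_ifs_lia.
  by move=> i lt_i; split_ifs_lia.
apply/(avoids_P3_P5P le_f mono_f) => b c d.
by rewrite /deep_profile35; split_ifs_lia.
Qed.

(** The parameters are recovered from the profile: y + 1 is the value at N, x + 1
    the first positive place, and z the first place with value y + 1. *)
Lemma card_deep35 : #|deep35| = 'C(n, 3).
Proof.
rewrite deep35E card_in_imset ?card_increasing_triples //.
move=> [[x y] z] [[x' y'] z']; rewrite !inE /= => /andP[xy yz] /andP[xy' yz'] /ffunP e.
have le_f a b c i : a < b -> b < c -> deep_profile35 a b c i <= i.
  by rewrite /deep_profile35; split_ifs_lia.
have ev i : i <= N -> deep_profile35 x y z i = deep_profile35 x' y' z' i.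
  move=> le_i; have lt_i : i < n by [].
  by have := congr1 val (e (Ordinal lt_i)); rewrite /= !profile_of_funE ?le_f.
have zN := leq_ord_max z; have zN' := leq_ord_max z'.
have le_x : x < N by lia.
have le_x' : x' < N by lia.
have ex := ev x.+1 le_x; have ex' := ev x'.+1 le_x'.
have ez := ev z zN; have ez' := ev z' zN'; have eN := ev N (leqnn N).
have ey : y = y'.
  by apply: val_inj; move: eN; rewrite /deep_profile35 /=; split_ifs_lia.
subst y'; have exx : x = x'.
  have lt_x : x' < x.+1.
    by rewrite ltnNge; apply/negP => lex; move: ex; rewrite /deep_profile35 lex ltnn xy.
  have lt_x' : x < x'.+1.
    by rewrite ltnNge; apply/negP => lex; move: ex'; rewrite /deep_profile35 lex ltnn xy'.
  by apply: val_inj; rewrite /=; lia.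
subst x'; have le_z : z' <= z by move: ez; rewrite /deep_profile35; split_ifs_lia.
have le_z' : z <= z' by move: ez'; rewrite /deep_profile35; split_ifs_lia.
by congr (_, _, _); apply: val_inj; rewrite /=; lia.
Qed.
End Deep.

(** * Counting and generating functions *)

(** Used with s the shallow profiles, which avoid P3, P4 and P5. *)
Lemma card_setId_split (T : finType) (A : {set T}) (s bad : pred T) :
  {in A, forall h, s h -> ~~ bad h} ->
  #|[set h in A | ~~ bad h]| =
  #|[set h in A | s h]| + #|[set h in A | ~~ s h & ~~ bad h]|.
Proof.
move=> good; rewrite -[LHS](cardsID [set h | s h]).
congr (_ + _); apply: eq_card => h; rewrite !in_set.
  rewrite -andbA; apply: andb_id2l => hP.
  by have [/(good h hP)->|_] := boolP (s h); rewrite ?andbF.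
by rewrite andbCA.
Qed.

Lemma shallow_avoids_P3_P4 N (h : {ffun 'I_N.+1 -> 'I_N.+1}) :
  h \in profiles N.+1 -> shallow h ->
  ~~ (contains (matching_of_profile h) P3 || contains (matching_of_profile h) P4).
Proof.
move=> hP /forallP sh; have [_ mono_h] := profilesP _ hP.
apply/(contains_P3_or_P4 hP) => -[b [c [d [b0 _ _ /andP[lt_bd _]]]]].
have := leq_trans lt_bd (mono_h d ord_max (leq_ord_max d)).
by rewrite ltnNge (implyP (sh b)).
Qed.

Lemma shallow_avoids_P3_P5 N (h : {ffun 'I_N.+1 -> 'I_N.+1}) :
  h \in profiles N.+1 -> shallow h ->
  ~~ (contains (matching_of_profile h) P3 || contains (matching_of_profile h) P5).
Proof.
move=> hP /forallP sh; have [_ mono_h] := profilesP _ hP.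
apply/(contains_P3_or_P5 hP) => -[b [c [d [c0 _ _ lt_cd]]]].
have := leq_trans lt_cd (mono_h d ord_max (leq_ord_max d)).
by rewrite ltnNge (implyP (sh c)).
Qed.

Definition avoiders_count (n : nat) : nat :=
  if n is N.+1 then 2 ^ N + 'C(n, 3) else 1.

Lemma profile0_mem (h : {ffun 'I_0 -> 'I_0}) : h \in profiles 0.
Proof. by apply/profilesP; split=> -[]. Qed.

Lemma card_profiles0 (good : pred {ffun 'I_0 -> 'I_0}) :
  (forall h, good h) -> #|[set h in profiles 0 | good h]| = 1.
Proof.
move=> gd; have c1 : #|{ffun 'I_0 -> 'I_0}| = 1 by rewrite card_ffun card_ord.
rewrite -[RHS]c1 -cardsT; apply: eq_card => h.
by rewrite in_setT; apply/setIdP; rewrite profile0_mem.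
Qed.

Lemma card_avoiders S n : S \in [:: [:: P1; P3; P4]; [:: P1; P3; P5]] ->
  #|stoimenow_avoiding n S| = avoiders_count n.
Proof.
rewrite !inE => /orP[]/eqP->; rewrite card_stoimenow_avoiding_P1.
all: case: n => [|N].
- apply: card_profiles0 => h; have hP := profile0_mem h.
  rewrite /= andbT; apply/andP; split; apply/negP.
    by case/(contains_P3 hP) => -[].
  by case/(contains_P4 hP) => -[].
- rewrite /= -card_shallow -card_deep34 -card_setId_split; last first.
    exact: shallow_avoids_P3_P4.
  by congr #|pred_of_set _|; apply/setP => h; apply/setIdP/setIdP; rewrite andbT negb_or.
- apply: card_profiles0 => h; have hP := profile0_mem h.
  rewrite /= andbT; apply/andP; split; apply/negP.
    by case/(contains_P3 hP) => -[].
  by case/(contains_P5 hP) => -[].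
- rewrite /= -card_shallow -card_deep35 -card_setId_split; last first.
    exact: shallow_avoids_P3_P5.
  by congr #|pred_of_set _|; apply/setP => h; apply/setIdP/setIdP; rewrite andbT negb_or.
Qed.

Local Open Scope ring_scope.

Lemma fps_mul_poly (R : comUnitRingType) (f g : fps R) n m : (n < m)%N ->
  fps_mul f g n = ((\poly_(i < m) f i) * (\poly_(i < m) g i))`_n.
Proof.
move=> lt_nm; rewrite coefM; apply: eq_bigr => i _.
have lt_i : (i < m)%N by apply: leq_ltn_trans lt_nm; rewrite -ltnS.
have lt_ni : (n - i < m)%N by apply: leq_ltn_trans lt_nm; apply: leq_subr.
by rewrite !coef_poly lt_i lt_ni.
Qed.

(** A coefficient of a product only depends on truncations of the factors, and
    truncated series multiply like polynomials. *)
Lemma fps_mulA (R : comUnitRingType) (f g k : fps R) :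
  fps_mul (fps_mul f g) k =1 fps_mul f (fps_mul g k).
Proof.
move=> n; pose F (a : fps R) : {poly R} := \poly_(i < n.+1) a i.
have trunc (p q r : {poly R}) :
    (forall i, (i <= n)%N -> p`_i = q`_i) -> (p * r)`_n = (q * r)`_n.
  move=> pq; rewrite !coefM; apply: eq_bigr => i _; rewrite pq // -ltnS.
  exact: ltn_ord.
have FM a b i : (i <= n)%N -> (F (fps_mul a b))`_i = (F a * F b)`_i.
  by move=> le_in; rewrite coef_poly ltnS le_in; apply: fps_mul_poly.
rewrite !(fps_mul_poly _ _ (ltnSn n)) -/(F _) -/(F k) -/(F f) -/(F (fps_mul g k)).
rewrite (trunc _ _ _ (FM f g)) -mulrA mulrC [in RHS]mulrC.
by apply/esym/trunc/FM.
Qed.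

(** Multiplying by the inverse of g, with associativity, turns f = a g into
    f / g = a. *)
Lemma fps_div_unique (R : comUnitRingType) (f g a : fps R) :
  g 0%N \is a GRing.unit -> fps_mul a g =1 f -> a =1 fps_div f g.
Proof.
move=> Ug agf n; rewrite /fps_div.
transitivity (fps_mul (fps_mul a g) (fps_inv g) n); last first.
  by apply: eq_bigr => i _; rewrite agf.
have inv i : fps_mul g (fps_inv g) i = (i == 0%N)%:R.
  by rewrite -[LHS]/(fps_div g g i) fps_divv // /fps_of_poly coef1.
rewrite fps_mulA.
transitivity (\sum_(i < n.+1) a i * (n - i == 0)%N%:R); last first.
  by apply: eq_bigr => i _; rewrite inv.
rewrite big_ord_recr /= subnn eqxx mulr1 big1 ?add0r // => i _.
by rewrite subn_eq0 leqNgt ltn_ord mulr0.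
Qed.

Definition numer : {poly int} :=
  1 - 5 *: 'X + 10 *: 'X^2 - 9 *: 'X^3 + 3 *: 'X^4 - 'X^5.
Definition denom : {poly int} := (1 - 'X) ^+ 4 * (1 - 2 *: 'X).

Lemma denomE :
  denom = 1 - 6 *: 'X + 14 *: 'X^2 - 16 *: 'X^3 + 9 *: 'X^4 - 2 *: 'X^5.
Proof. rewrite /denom !scaler_nat; ring. Qed.

Lemma coef_denom k :
  denom`_k = nth 0 [:: 1; -6; 14; -16; 9; -2] k.
Proof.
rewrite denomE !(coefE, coefZ); case: k => [|[|[|[|[|[|k]]]]]] //=.
by rewrite nth_nil.
Qed.

Lemma coef_numer k : numer`_k = nth 0 [:: 1; -5; 10; -9; 3; -1] k.
Proof.
rewrite /numer !(coefE, coefZ); case: k => [|[|[|[|[|[|k]]]]]] //=.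
by rewrite nth_nil.
Qed.

(** Beyond degree 5 the numerator vanishes and the claim is the linear recurrence
    with characteristic polynomial (X - 1) ^ 4 (X - 2), satisfied by 2 ^ N and by
    cubic polynomials; Pascal's rule reduces it to a linear identity.  The value
    at n = 0 does not follow the general formula, so the degrees up to 5 are
    checked one by one. *)
Lemma avoiders_count_mul_denom :
  fps_mul (fun n => (avoiders_count n)%:Z) (fps_of_poly denom) =1 fps_of_poly numer.
Proof.
move=> n; rewrite /fps_mul /fps_of_poly coef_numer.
under eq_bigr => i _ do rewrite coef_denom.
case: n => [|[|[|[|[|[|m]]]]]]; try by rewrite !big_ord_recr big_ord0.
(* Only the last six terms meet a nonzero coefficient of the denominator. *)
rewrite 6!big_ord_recr /= big1 => [|i _]; last first.
  by rewrite nth_default ?mulr0 //= ; have := ltn_ord i; lia.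
rewrite !subSS.
have e k : (k + m - m = k)%N := addnK m k.
rewrite (e 5) (e 4) (e 3) (e 2) (e 1) (e 0) /=.
rewrite !binS !bin0 !expnS nth_nil; lia.
Qed.

Theorem theorem4p3 (S : seq {set {set 'I_(4.*2)}})
    (hS : S \in [:: [:: P1; P3; P4]; [:: P1; P3; P5]]) :
  avoid_gf S =1
  fps_div
    (fps_of_poly (1 - 5 *: 'X + 10 *: 'X^2 - 9 *: 'X^3 + 3 *: 'X^4 - 'X^5))
    (fps_of_poly ((1 - 'X) ^+ 4 * (1 - 2 *: 'X))).
Proof.
apply: fps_div_unique; first by rewrite /fps_of_poly coef_denom.
move=> n; rewrite -[RHS]avoiders_count_mul_denom.
by apply: eq_bigr => i _; rewrite /avoid_gf card_avoiders.
Qed.
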